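(* Let $C$ be a 2-monoidal category with monoidal structures $\otimes_h$ and $\otimes_v$ and common unit $I$. Then the family of composites, for objects $a,b$ of $C$, $$a\otimes_h b \xrightarrow{\ \beta_a^{-1}\otimes_h\tau_b^{-1}\ } (a\otimes_v I)\otimes_h(I\otimes_v b) = (a\otimes_h I)\otimes_v(I\otimes_h b)\xrightarrow{\ r_a\otimes_v l_b\ } a\otimes_v b \xrightarrow{\ l_a^{-1}\otimes_v r_b^{-1}\ } (I\otimes_h a)\otimes_v(b\otimes_h I) = (I\otimes_v b)\otimes_h(a\otimes_v I)\xrightarrow{\ \tau_b\otimes_h\beta_a\ } b\otimes_h a$$ is a braiding on the monoidal category $(C,\otimes_h,I)$.
   Context: A (semi-strict) 2-monoidal category is a category $A$ equipped with two (weak) monoidal structures, $(\otimes_v,V,\alpha^v,\tau,\beta)$ and $(\otimes_h,H,\alpha^h,l,r)$, where $\alpha^v,\alpha^h$ are the associativity isomorphisms (in the direction $(x\otimes y)\otimes z\to x\otimes(y\otimes z)$) and the unit isomorphisms are $\tau_a:V\otimes_v a\to a$, $\beta_a:a\otimes_v V\to a$, $l_a:H\otimes_h a\to a$, $r_a:a\otimes_h H\to a$, satisfying the following for all objects $a,b,c,d,e,f$: (1) $V=H$ (this common unit is written $I$), $H\otimes_v H=H$, $\alpha^v_{H,H,H}=\mathrm{id}$, $\beta_H=\mathrm{id}$, $\tau_H=\mathrm{id}$; (2) strict interchange: $(a\otimes_h b)\otimes_v(c\otimes_h d)=(a\otimes_v c)\otimes_h(b\otimes_v d)$, on objects and on morphisms;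 $V\otimes_h V=V$; $\alpha^v_{a\otimes_h b,\,c\otimes_h d,\,e\otimes_h f}=\alpha^v_{a,c,e}\otimes_h\alpha^v_{b,d,f}$; $\beta_{a\otimes_h b}=\beta_a\otimes_h\beta_b$; $\tau_{a\otimes_h b}=\tau_a\otimes_h\tau_b$; (3) $\alpha^h_{a,b,c}\otimes_v\alpha^h_{d,e,f}=\alpha^h_{a\otimes_v d,\,b\otimes_v e,\,c\otimes_v f}$; $l_a\otimes_v l_b=l_{a\otimes_v b}$; $r_a\otimes_v r_b=r_{a\otimes_v b}$; $\alpha^h_{V,V,V}=\mathrm{id}$; $l_V=\mathrm{id}$; $r_V=\mathrm{id}$. (Here equations between morphisms use the equalities of objects given by interchange and the unit equalities.) *)

(* Defs.v *)
Set Implicit Arguments.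
Unset Strict Implicit.
Unset Printing Implicit Defensive.

Declare Scope cat_scope.
Delimit Scope cat_scope with cat.
Local Open Scope cat_scope.

Reserved Notation "f ;; g" (at level 50, left associativity).
Reserved Notation "f == g" (at level 70, no associativity).
Reserved Notation "a *v b" (at level 40, left associativity).
Reserved Notation "a *h b" (at level 40, left associativity).
Reserved Notation "f **v g" (at level 40, left associativity).
Reserved Notation "f **h g" (at level 40, left associativity).

(* Composition is written in diagrammatic order: [f ;; g] is "f, then g". *)
Record category := Category {
  ob :> Type;
  hom : ob -> ob -> Type;
  idm : forall a : ob, hom a a;
  comp : forall a b c : ob, hom a b -> hom b c -> hom a c
    where "f ;; g" := (comp f g);
  comp_idl : forall (a b : ob) (f : hom a b), idm a ;; f = f;
  comp_idr : forall (a b : ob) (f : hom a b), f ;; idm b = f;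
  comp_assoc : forall (a b c d : ob) (f : hom a b) (g : hom b c) (k : hom c d),
    (f ;; g) ;; k = f ;; (g ;; k)
}.

Arguments hom {_} a b.
Arguments idm {_} a.
Arguments comp {_ _ _ _} f g.

Notation "f ;; g" := (comp f g) : cat_scope.

(* Equality of morphisms whose sources and targets are equal objects, but
   not syntactically so: [f == g] is equality in the collection of all
   morphisms of C, hence entails equality of the sources and of the targets.
   It is how an equation between morphisms "using equalities of objects" is
   read. *)
Inductive hom_eq (C : category) (a b : C) (f : hom a b) :
    forall c d : C, hom c d -> Prop :=
  | hom_eq_refl : hom_eq f f.

Notation "f == g" := (hom_eq f g) : cat_scope.

(* An equality of objects, as the identity morphism it denotes. *)
Definition eq_hom (C : category) (a b : C) (p : a = b) : hom a b :=
  match p in _ = c return hom a c with eq_refl => idm a end.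

Record iso (C : category) (a b : C) := Iso {
  fwd :> hom a b;
  inv : hom b a;
  iso_fwd_inv : fwd ;; inv = idm a;
  iso_inv_fwd : inv ;; fwd = idm b
}.

Definition is_iso (C : category) (a b : C) (f : hom a b) : Prop :=
  exists g : hom b a, f ;; g = idm a /\ g ;; f = idm b.

(* (Weak) monoidal structures on C with unit object I. The unit is a
   parameter so that two structures can share it. *)
Record monoidal (C : category) (I : C) := Monoidal {
  tob : C -> C -> C;
  tmor : forall a b c d : C, hom a b -> hom c d -> hom (tob a c) (tob b d);
  tmor_id : forall a b : C, tmor (idm a) (idm b) = idm (tob a b);
  tmor_comp : forall (a b c a' b' c' : C)
      (f : hom a b) (g : hom b c) (f' : hom a' b') (g' : hom b' c'),
    tmor (f ;; g) (f' ;; g') = tmor f f' ;; tmor g g';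

  assoc : forall a b c : C, iso (tob (tob a b) c) (tob a (tob b c));
  lunit : forall a : C, iso (tob I a) a;
  runit : forall a : C, iso (tob a I) a;

  assoc_nat : forall (a b c a' b' c' : C)
      (f : hom a a') (g : hom b b') (k : hom c c'),
    tmor (tmor f g) k ;; assoc a' b' c' = assoc a b c ;; tmor f (tmor g k);
  lunit_nat : forall (a b : C) (f : hom a b),
    tmor (idm I) f ;; lunit b = lunit a ;; f;
  runit_nat : forall (a b : C) (f : hom a b),
    tmor f (idm I) ;; runit b = runit a ;; f;

  pentagon : forall a b c d : C,
    tmor (assoc a b c) (idm d) ;; assoc a (tob b c) d
      ;; tmor (idm a) (assoc b c d)
    = assoc (tob a b) c d ;; assoc a b (tob c d);
  triangle : forall a b : C,
    assoc a I b ;; tmor (idm a) (lunit b) = tmor (runit a) (idm b)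
}.

Record is_braiding (C : category) (I : C) (M : monoidal I)
    (c : forall a b : C, hom (tob M a b) (tob M b a)) : Prop := IsBraiding {
  braiding_iso : forall a b : C, is_iso (c a b);
  braiding_nat : forall (a b a' b' : C) (f : hom a a') (g : hom b b'),
    tmor M f g ;; c a' b' = c a b ;; tmor M g f;
  hexagon_fwd : forall x y z : C,
    assoc M x y z ;; c x (tob M y z) ;; assoc M y z x
    = tmor M (c x y) (idm z) ;; assoc M y x z ;; tmor M (idm y) (c x z);
  hexagon_inv : forall x y z : C,
    inv (assoc M x y z) ;; c (tob M x y) z ;; inv (assoc M z x y)
    = tmor M (idm x) (c y z) ;; inv (assoc M x z y) ;; tmor M (c x z) (idm y)
}.

Record two_monoidal_category := TwoMonoidalCategory {
  carrier :> category;
  unit_ob : carrier;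
  vmon : monoidal unit_ob;
  hmon : monoidal unit_ob
    where "a *v b" := (tob vmon a b)
    and "a *h b" := (tob hmon a b)
    and "f **v g" := (tmor vmon f g)
    and "f **h g" := (tmor hmon f g);

  vunit_unit : unit_ob *v unit_ob = unit_ob;
  vassoc_unit : assoc vmon unit_ob unit_ob unit_ob == idm unit_ob;
  vrunit_unit : runit vmon unit_ob == idm unit_ob;
  vlunit_unit : lunit vmon unit_ob == idm unit_ob;

  interchange : forall a b c d : carrier,
    (a *h b) *v (c *h d) = (a *v c) *h (b *v d);
  interchange_mor : forall (a b c d a' b' c' d' : carrier)
      (f : hom a a') (g : hom b b') (k : hom c c') (m : hom d d'),
    (f **h g) **v (k **h m) == (f **v k) **h (g **v m);
  hunit_unit : unit_ob *h unit_ob = unit_ob;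
  vassoc_h : forall a b c d e f : carrier,
    assoc vmon (a *h b) (c *h d) (e *h f)
    == assoc vmon a c e **h assoc vmon b d f;
  vrunit_h : forall a b : carrier,
    runit vmon (a *h b) == runit vmon a **h runit vmon b;
  vlunit_h : forall a b : carrier,
    lunit vmon (a *h b) == lunit vmon a **h lunit vmon b;

  hassoc_v : forall a b c d e f : carrier,
    assoc hmon a b c **v assoc hmon d e f
    == assoc hmon (a *v d) (b *v e) (c *v f);
  hlunit_v : forall a b : carrier,
    lunit hmon a **v lunit hmon b == lunit hmon (a *v b);
  hrunit_v : forall a b : carrier,
    runit hmon a **v runit hmon b == runit hmon (a *v b);
  hassoc_unit : assoc hmon unit_ob unit_ob unit_ob == idm unit_ob;
  hlunit_unit : lunit hmon unit_ob == idm unit_ob;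
  hrunit_unit : runit hmon unit_ob == idm unit_ob
}.

Notation "a *v b" := (tob (vmon _) a b) : cat_scope.
Notation "a *h b" := (tob (hmon _) a b) : cat_scope.
Notation "f **v g" := (tmor (vmon _) f g) : cat_scope.
Notation "f **h g" := (tmor (hmon _) f g) : cat_scope.

Definition eh_braiding (C : two_monoidal_category) (a b : C) :
    hom (a *h b) (b *h a) :=
  let I := unit_ob C in
  let beta := runit (vmon C) in
  let tau := lunit (vmon C) in
  let r := runit (hmon C) in
  let l := lunit (hmon C) in
  (inv (beta a) **h inv (tau b) : hom (a *h b) ((a *v I) *h (I *v b)))
  ;; eq_hom (eq_sym (interchange a I I b))
  ;; (r a **v l b : hom ((a *h I) *v (I *h b)) (a *v b))
  ;; (inv (l a) **v inv (r b) : hom (a *v b) ((I *h a) *v (b *h I)))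
  ;; eq_hom (interchange I a b I)
  ;; (tau b **h beta a : hom ((I *v b) *h (a *v I)) (b *h a)).

(* Main.v *)
Require Import Defs.
From Stdlib Require Import ssreflect Eqdep.

Set Implicit Arguments.
Unset Strict Implicit.
Unset Printing Implicit Defensive.

Local Open Scope cat_scope.

(** This is the Eckmann-Hilton argument in the form of Joyal and Street.  The
    strict interchange law is used only through the isomorphisms
    [swap : (a *h b) *v (c *h d) -> (a *v c) *h (b *v d)] that it provides:
    they are natural, they turn the associators of h tensored by v into the
    associators of h, and they split the v-unit isomorphisms at a tensor
    [a *h b].  These are ordinary equations between composable arrows
    ([weak_interchange]), so that equalities of objects can be forgotten as
    soon as [strict_interchange] has checked them; there the uniqueness of
    identity proofs makes any two equality arrows with the same ends equal.

    Inserting units and swapping gives [vh_iso : a *v b -> a *h b] and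
    [vh_flip : a *v b -> b *h a], and the braiding is the inverse of the first
    followed by the second.  It is a natural isomorphism by construction.

    The three braidings in the hexagon on x, y, z pass through
    [x *v (y *h z)], [(x *v y) *h z] and [y *h (x *v z)].  The distributors
    [dist_left] and [dist_right] lead from the first of these objects to the
    other two and cut the hexagon into three commuting diagrams,
    [dist_left_vh_iso], [dist_left_vh_flip] and [dist_right_vh_flip].  In each
    of them both sides can be brought to the form
    [(F **v G) ;; swap ;; (id **h swap) ;; (three unit isomorphisms)], by
    [swap_left], [swap_right] and [swap_lunit_inv], with F and G made of
    structural arrows of h alone.  The two values of F, and those of G, agree
    by the triangle axiom, naturality, and Kelly's consequences of the axioms
    for units.

    The second hexagon is the first one for the structure in which both tensor
    products are reversed, because reversal sends the braiding at (a, b)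
    to the braiding at (b, a) and the associators to their inverses. *)

(** * Isomorphisms *)

(** For rewriting in the middle of a composite bracketed to the right, where
    [f ;; g] is not a subterm. *)
Lemma comp_cut (C : category) (a b c d : C) (f : hom a b) (g : hom b c)
    (k : hom a c) (m : hom c d) :
  f ;; g = k -> f ;; (g ;; m) = k ;; m.
Proof. by move=> <-; rewrite comp_assoc. Qed.

Definition id_iso (C : category) (a : C) : iso a a :=
  Iso (comp_idl (idm a)) (comp_idl (idm a)).

Definition inv_iso (C : category) (a b : C) (f : iso a b) : iso b a :=
  Iso (iso_inv_fwd f) (iso_fwd_inv f).

Definition comp_iso (C : category) (a b c : C) (f : iso a b) (g : iso b c) :
  iso a c.
Proof.
refine (@Iso C a c (f ;; g) (inv g ;; inv f) _ _).
- by rewrite comp_assoc (comp_cut _ (iso_fwd_inv g)) comp_idl iso_fwd_inv.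
- by rewrite comp_assoc (comp_cut _ (iso_inv_fwd f)) comp_idl iso_inv_fwd.
Defined.

Definition tmor_iso (C : category) (I : C) (M : monoidal I) (a b c d : C)
  (f : iso a b) (g : iso c d) : iso (tob M a c) (tob M b d).
Proof.
refine (@Iso C _ _ (tmor M f g) (tmor M (inv f) (inv g)) _ _).
- by rewrite -tmor_comp !iso_fwd_inv tmor_id.
- by rewrite -tmor_comp !iso_inv_fwd tmor_id.
Defined.

Lemma iso_is_iso (C : category) (a b : C) (f : iso a b) : is_iso f.
Proof. by exists (inv f); split; [exact: iso_fwd_inv | exact: iso_inv_fwd]. Qed.

Lemma comp_isoI (C : category) (a b c : C) (f : iso a b) (g k : hom b c) :
  f ;; g = f ;; k -> g = k.
Proof.
move=> e; rewrite -[g]comp_idl -[k]comp_idl -(iso_inv_fwd f) !comp_assoc.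
by rewrite e.
Qed.

Lemma isoI_comp (C : category) (a b c : C) (f : iso b c) (g k : hom a b) :
  g ;; f = k ;; f -> g = k.
Proof.
move=> e; rewrite -[g]comp_idr -[k]comp_idr -(iso_fwd_inv f) -!comp_assoc.
by rewrite e.
Qed.

Lemma inv_ext (C : category) (a b : C) (f g : iso a b) :
  fwd f = fwd g -> inv f = inv g.
Proof.
by move=> e; apply: (comp_isoI (f := f)); rewrite iso_fwd_inv e iso_fwd_inv.
Qed.

Lemma iso_square_inv (C : category) (a b c d : C) (i : iso a b) (j : iso c d)
    (f : hom a c) (g : hom b d) :
  f ;; j = i ;; g -> inv i ;; f = g ;; inv j.
Proof.
move=> e; apply: (comp_isoI (f := i)); apply: (isoI_comp (f := j)).
rewrite !comp_assoc iso_inv_fwd comp_idr (comp_cut _ (iso_fwd_inv i)).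
by rewrite comp_idl e.
Qed.

(** * Units in a monoidal category *)

Section Monoidal.
Variables (C : category) (I : C) (M : monoidal I).
Local Notation "a * b" := (tob M a b).
Local Notation "f ** g" := (tmor M f g) (at level 40, left associativity).

Lemma tmor_compl (a b c d : C) (f : hom a b) (g : hom b c) :
  (f ;; g) ** idm d = (f ** idm d) ;; (g ** idm d).
Proof. by rewrite -tmor_comp comp_idl. Qed.

Lemma tmor_compr (a b c d : C) (f : hom a b) (g : hom b c) :
  idm d ** (f ;; g) = (idm d ** f) ;; (idm d ** g).
Proof. by rewrite -tmor_comp comp_idl. Qed.

Lemma tmor_lunit_inj (a b : C) (f g : hom a b) :
  idm I ** f = idm I ** g -> f = g.
Proof.
move=> e; apply: (comp_isoI (f := lunit M a)).
by rewrite -!lunit_nat e.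
Qed.

Lemma tmor_runit_inj (a b : C) (f g : hom a b) :
  f ** idm I = g ** idm I -> f = g.
Proof.
move=> e; apply: (comp_isoI (f := runit M a)).
by rewrite -!runit_nat e.
Qed.

(** Kelly's redundancy: tensoring by I on the left is faithful, and after it
    the equation becomes a face of the pentagon on I, I, a, b whose other faces
    are triangles and naturality squares. *)
Lemma assoc_lunit (a b : C) :
  assoc M I a b ;; lunit M (a * b) = lunit M a ** idm b.
Proof.
apply: tmor_lunit_inj.
apply: (comp_isoI (f := assoc M I (I * a) b)).
apply: (comp_isoI (f := tmor_iso M (assoc M I I a) (id_iso b))) => /=.
rewrite tmor_compr -assoc_nat -2!comp_assoc pentagon.
rewrite comp_assoc triangle -comp_assoc -tmor_compl triangle.
by rewrite assoc_nat tmor_id.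
Qed.

(** Reversal exchanges the two unit isomorphisms and inverts the associator; it
    turns every statement about left units into one about right units. *)
Definition rev_monoidal : monoidal I.
Proof.
refine (@Monoidal C I (fun a b => b * a) (fun a b c d f g => g ** f) _ _
  (fun a b c => inv_iso (assoc M c b a)) (fun a => runit M a)
  (fun a => lunit M a) _ _ _ _ _) => /=.
- by move=> a b; exact: tmor_id.
- by move=> *; exact: tmor_comp.
- move=> a b c a' b' c' f g k; symmetry; apply: iso_square_inv.
  by rewrite assoc_nat.
- by move=> *; exact: runit_nat.
- by move=> *; exact: lunit_nat.
- move=> a b c d.
  pose p := comp_iso (comp_iso (tmor_iso M (assoc M d c b) (id_iso a))
    (assoc M d (c * b) a)) (tmor_iso M (id_iso d) (assoc M c b a)).
  pose q := comp_iso (assoc M (d * c) b a) (assoc M d c (b * a)).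
  have := @inv_ext C _ _ p q (pentagon M d c b a).
  by rewrite /= comp_assoc => ->.
- move=> a b; rewrite -triangle -comp_assoc iso_inv_fwd.
  exact: comp_idl.
Defined.

End Monoidal.

Section Units.
Variables (C : category) (I : C) (M : monoidal I).
Local Notation "a * b" := (tob M a b).
Local Notation "f ** g" := (tmor M f g) (at level 40, left associativity).

Lemma assoc_runit (a b : C) :
  assoc M a b I ;; (idm a ** runit M b) = runit M (a * b).
Proof.
have /= <- := assoc_lunit (rev_monoidal M) b a.
by rewrite -comp_assoc iso_fwd_inv comp_idl.
Qed.

(** Both isomorphisms become equal after tensoring with I on the right: one by
    the triangle, the other by Kelly's identity, the two differing by
    [lunit (I * I) = id ** lunit I], which is naturality of [lunit]. *)
Lemma lunit_runit : fwd (lunit M I) = runit M I.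
Proof.
apply: (@tmor_runit_inj _ _ M); rewrite -triangle -assoc_lunit; congr (_ ;; _).
by apply: (isoI_comp (f := lunit M I)); rewrite lunit_nat.
Qed.

Lemma lunit_inv_nat (a b : C) (f : hom a b) :
  f ;; inv (lunit M b) = inv (lunit M a) ;; (idm I ** f).
Proof. by symmetry; apply: iso_square_inv; rewrite lunit_nat. Qed.

Lemma runit_inv_nat (a b : C) (f : hom a b) :
  f ;; inv (runit M b) = inv (runit M a) ;; (f ** idm I).
Proof. by symmetry; apply: iso_square_inv; rewrite runit_nat. Qed.

Lemma triangle_inv (a b : C) :
  (inv (runit M a) ** idm b) ;; assoc M a I b = idm a ** inv (lunit M b).
Proof.
apply: (isoI_comp (f := tmor_iso M (id_iso a) (lunit M b))) => /=.
by rewrite comp_assoc triangle -!tmor_comp !iso_inv_fwd !comp_idl.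
Qed.

Lemma assoc_lunit_inv (a b : C) :
  (inv (lunit M a) ** idm b) ;; assoc M I a b = inv (lunit M (a * b)).
Proof.
apply: (isoI_comp (f := lunit M (a * b))).
by rewrite comp_assoc assoc_lunit -tmor_comp !iso_inv_fwd comp_idl tmor_id.
Qed.

Lemma assoc_runit_inv (a b : C) :
  inv (runit M (a * b)) ;; assoc M a b I = idm a ** inv (runit M b).
Proof.
apply: (isoI_comp (f := tmor_iso M (id_iso a) (runit M b))) => /=.
by rewrite comp_assoc assoc_runit -tmor_comp !iso_inv_fwd comp_idl tmor_id.
Qed.

Lemma lunit_runit_inv : inv (lunit M I) = inv (runit M I).
Proof. exact: inv_ext lunit_runit. Qed.

End Units.

(** * Interchange up to isomorphism *)

(** The interchange law as a natural isomorphism.  Where a strict structure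
    identifies the unit I with [tob H I I], here [lunit H I] or [runit H I]
    occurs.  With [lunit] in [swap_lunit] and [runit] in [swap_runit], reversal
    exchanges the two axioms. *)
Record weak_interchange (C : category) (I : C) (V H : monoidal I) :=
  WeakInterchange {
  swap : forall a b c d : C,
    iso (tob V (tob H a b) (tob H c d)) (tob H (tob V a c) (tob V b d));
  swap_nat : forall (a b c d a' b' c' d' : C)
      (f : hom a a') (g : hom b b') (k : hom c c') (m : hom d d'),
    tmor V (tmor H f g) (tmor H k m) ;; swap a' b' c' d'
    = swap a b c d ;; tmor H (tmor V f k) (tmor V g m);
  swap_assoc : forall a b c d e f : C,
    swap (tob H a b) c (tob H d e) f ;; tmor H (swap a b d e) (idm (tob V c f))
      ;; assoc H (tob V a d) (tob V b e) (tob V c f)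
    = tmor V (assoc H a b c) (assoc H d e f)
      ;; swap a (tob H b c) d (tob H e f)
      ;; tmor H (idm (tob V a d)) (swap b c e f);
  swap_lunit : forall a b : C,
    swap I I a b ;; tmor H (lunit V a) (lunit V b)
    = tmor V (lunit H I) (idm (tob H a b)) ;; lunit V (tob H a b);
  swap_runit : forall a b : C,
    swap a b I I ;; tmor H (runit V a) (runit V b)
    = tmor V (idm (tob H a b)) (runit H I) ;; runit V (tob H a b)
}.

Definition rev_interchange (C : category) (I : C) (V H : monoidal I)
  (S : weak_interchange V H) :
  weak_interchange (rev_monoidal V) (rev_monoidal H).
Proof.
refine (@WeakInterchange C I (rev_monoidal V) (rev_monoidal H)
  (fun a b c d => swap S d c b a) _ _ _ _) => /=.
- by move=> *; exact: swap_nat.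
- move=> a b c d e f; symmetry; rewrite comp_assoc.
  pose i := tmor_iso V (assoc H f e d) (assoc H c b a).
  pose j := assoc H (tob V f c) (tob V e b) (tob V d a).
  (* Reversal inverts the associators, so the axiom becomes the original one
     with both associators moved to the other side. *)
  apply: (@iso_square_inv C _ _ _ _ i j) => /=.
  by rewrite swap_assoc comp_assoc.
- by move=> a b; rewrite swap_runit.
- by move=> a b; rewrite swap_lunit.
Defined.

(** * The Eckmann-Hilton braiding *)

Section EckmannHilton.
Variables (C : category) (I : C) (V H : monoidal I) (S : weak_interchange V H).
Local Notation "a *v b" := (tob V a b).
Local Notation "a *h b" := (tob H a b).
Local Notation "f **v g" := (tmor V f g).
Local Notation "f **h g" := (tmor H f g).
Local Notation l := (lunit H).
Local Notation r := (runit H).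
Local Notation tau := (lunit V).
Local Notation beta := (runit V).

Definition vh_iso (a b : C) : iso (a *v b) (a *h b) :=
  comp_iso (tmor_iso V (inv_iso (r a)) (inv_iso (l b)))
    (comp_iso (swap S a I I b) (tmor_iso H (beta a) (tau b))).

Definition vh_flip (a b : C) : iso (a *v b) (b *h a) :=
  comp_iso (tmor_iso V (inv_iso (l a)) (inv_iso (r b)))
    (comp_iso (swap S I a b I) (tmor_iso H (tau b) (beta a))).

Definition swap_braiding (a b : C) : hom (a *h b) (b *h a) :=
  inv (vh_iso a b) ;; vh_flip a b.

Lemma vh_iso_nat (a b a' b' : C) (f : hom a a') (g : hom b b') :
  (f **v g) ;; vh_iso a' b' = vh_iso a b ;; (f **h g).
Proof.
rewrite /= (comp_cut _ (eq_sym (tmor_comp V _ _ _ _))).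
rewrite runit_inv_nat lunit_inv_nat tmor_comp !comp_assoc.
rewrite (comp_cut _ (swap_nat S _ _ _ _)) comp_assoc.
by rewrite -!tmor_comp runit_nat lunit_nat.
Qed.

Lemma vh_flip_nat (a b a' b' : C) (f : hom a a') (g : hom b b') :
  (f **v g) ;; vh_flip a' b' = vh_flip a b ;; (g **h f).
Proof.
rewrite /= (comp_cut _ (eq_sym (tmor_comp V _ _ _ _))).
rewrite runit_inv_nat lunit_inv_nat tmor_comp !comp_assoc.
rewrite (comp_cut _ (swap_nat S _ _ _ _)) comp_assoc.
by rewrite -!tmor_comp runit_nat lunit_nat.
Qed.

Lemma swap_braiding_nat (a b a' b' : C) (f : hom a a') (g : hom b b') :
  (f **h g) ;; swap_braiding a' b' = swap_braiding a b ;; (g **h f).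
Proof.
rewrite /swap_braiding comp_assoc -vh_flip_nat -2!comp_assoc; congr (_ ;; _).
by symmetry; apply: iso_square_inv; exact: vh_iso_nat.
Qed.

(** Two successive splittings, the second one in the left factor, can be
    reassociated before being swapped: this is [swap_assoc] together with
    naturality. *)
Lemma swap_left (x y a b c d a1 a2 c1 c2 : C)
    (f : hom x (a *h b)) (f' : hom a (a1 *h a2))
    (g : hom y (c *h d)) (g' : hom c (c1 *h c2)) :
  (f **v g) ;; swap S a b c d
    ;; (((f' **v g') ;; swap S a1 a2 c1 c2) **h idm (b *v d))
    ;; assoc H (a1 *v c1) (a2 *v c2) (b *v d)
  = ((f ;; ((f' **h idm b) ;; assoc H a1 a2 b))
       **v (g ;; ((g' **h idm d) ;; assoc H c1 c2 d)))
    ;; swap S a1 (a2 *h b) c1 (c2 *h d)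
    ;; (idm (a1 *v c1) **h swap S a2 b c2 d).
Proof.
rewrite tmor_compl !tmor_comp !comp_assoc; congr (_ ;; _).
rewrite -(comp_assoc (tmor V _ _) (swap _ _ _ _ _)) -swap_assoc !comp_assoc.
by rewrite (comp_cut _ (swap_nat S _ _ _ _)) comp_assoc tmor_id.
Qed.

(** The counterpart for a second splitting in the right factor, which brings
    both bracketings to a common normal form. *)
Lemma swap_right (x y a b c d b1 b2 d1 d2 : C)
    (f : hom x (a *h b)) (f' : hom b (b1 *h b2))
    (g : hom y (c *h d)) (g' : hom d (d1 *h d2)) :
  (f **v g) ;; swap S a b c d
    ;; (idm (a *v c) **h ((f' **v g') ;; swap S b1 b2 d1 d2))
  = ((f ;; (idm a **h f')) **v (g ;; (idm c **h g')))
    ;; swap S a (b1 *h b2) c (d1 *h d2)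
    ;; (idm (a *v c) **h swap S b1 b2 d1 d2).
Proof.
rewrite tmor_compr !tmor_comp !comp_assoc; congr (_ ;; _).
by rewrite (comp_cut _ (swap_nat S _ _ _ _)) comp_assoc tmor_id.
Qed.

Definition dist_left (x y z : C) : hom (x *v (y *h z)) ((x *v y) *h z) :=
  (inv (r x) **v idm (y *h z)) ;; swap S x I y z ;; (idm (x *v y) **h tau z).

Definition dist_right (x y z : C) : hom (x *v (y *h z)) (y *h (x *v z)) :=
  (inv (l x) **v idm (y *h z)) ;; swap S I x y z ;; (tau y **h idm (x *v z)).

Lemma swap_lunit_inv (a b : C) :
  (inv (l I) **v idm (a *h b)) ;; (swap S I I a b ;; (tau a **h tau b))
  = tau (a *h b).
Proof.
rewrite swap_lunit -comp_assoc -tmor_comp iso_inv_fwd comp_idl.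
by rewrite tmor_id comp_idl.
Qed.

(** After [swap_left], the two components are the triangle at x, I, I and
    Kelly's identity at I, y, z; the extra splitting of I left over is
    absorbed by [swap_lunit_inv]. *)
Lemma dist_left_vh_iso (x y z : C) :
  dist_left x y z ;; (vh_iso x y **h idm z) ;; assoc H x y z
  = vh_iso x (y *h z).
Proof.
transitivity ((inv (r x) **v idm (y *h z)) ;; swap S x I y z
  ;; (((inv (r x) **v inv (l y)) ;; swap S x I I y) **h idm (I *v z))
  ;; assoc H (x *v I) (I *v y) (I *v z)
  ;; (beta x **h (tau y **h tau z))).
  rewrite /dist_left !comp_assoc -assoc_nat; do 2 congr (_ ;; _).
  rewrite -!comp_assoc -!tmor_comp /= !comp_idl !comp_assoc.
  by rewrite !comp_idr.
rewrite swap_left comp_idl triangle_inv assoc_lunit_inv.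
transitivity ((inv (r x) **v inv (l (y *h z)))
  ;; (((idm x **h inv (l I)) **v idm (I *h (y *h z)))
  ;; swap S x (I *h I) I (y *h z)
  ;; (beta x **h (swap S I I y z ;; (tau y **h tau z))))).
  rewrite !comp_assoc (comp_cut _ (eq_sym (tmor_comp V _ _ _ _))) comp_idr.
  by rewrite -(tmor_comp H) comp_idl.
rewrite -(tmor_id H I (y *h z)) swap_nat comp_assoc -(tmor_comp H).
by rewrite swap_lunit_inv tmor_id comp_idl.
Qed.

(** Both sides split x as [I *h (x *h I)] and y *h z as [y *h (I *h z)]: in the
    first component the two ways agree by Kelly's identity and naturality of
    the left unit, in the second by the triangle. *)
Lemma dist_left_vh_flip (x y z : C) :
  dist_left x y z ;; (vh_flip x y **h idm z) ;; assoc H y x z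
  = dist_right x y z ;; (idm y **h vh_iso x z).
Proof.
transitivity ((inv (r x) **v idm (y *h z)) ;; swap S x I y z
  ;; (((inv (l x) **v inv (r y)) ;; swap S I x y I) **h idm (I *v z))
  ;; assoc H (I *v y) (x *v I) (I *v z)
  ;; (tau y **h (beta x **h tau z))).
  rewrite /dist_left !comp_assoc -assoc_nat; do 2 congr (_ ;; _).
  rewrite -!comp_assoc -!tmor_comp /= !comp_idl !comp_assoc.
  by rewrite !comp_idr.
rewrite swap_left comp_idl triangle_inv assoc_lunit_inv.
rewrite lunit_inv_nat -[X in _ **v X]comp_idl -swap_right.
rewrite /dist_right !comp_assoc; do 2 congr (_ ;; _).
by rewrite -!tmor_comp /= !comp_idl comp_idr !comp_assoc.
Qed.

(** Here [swap_lunit_inv] first resolves [tau (y *h z)] into the two v-units,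
    which produces the nested splitting that [swap_left] expects.  The first
    component then compares the two ways of splitting x as [I *h (I *h x)],
    hence the use of [lunit_runit_inv]. *)
Lemma dist_right_vh_flip (x y z : C) :
  dist_right x y z ;; (idm y **h vh_flip x z)
  = vh_flip x (y *h z) ;; assoc H y z x.
Proof.
symmetry.
transitivity ((inv (l x) **v inv (r (y *h z))) ;; swap S I x (y *h z) I
  ;; (((inv (l I) **v idm (y *h z)) ;; swap S I I y z) **h idm (x *v I))
  ;; assoc H (I *v y) (I *v z) (x *v I)
  ;; (tau y **h (tau z **h beta x))).
  rewrite /= !comp_assoc -assoc_nat; do 2 congr (_ ;; _).
  by rewrite -!comp_assoc -!tmor_comp comp_idl comp_assoc swap_lunit_inv.
rewrite swap_left lunit_runit_inv triangle_inv.
rewrite tmor_id comp_idl assoc_runit_inv -[X in _ **v X]comp_idl -swap_right.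
rewrite /dist_right !comp_assoc; do 2 congr (_ ;; _).
by rewrite -!tmor_comp /= !comp_idl comp_idr !comp_assoc.
Qed.

Lemma swap_braiding_hexagon (x y z : C) :
  assoc H x y z ;; swap_braiding x (y *h z) ;; assoc H y z x
  = (swap_braiding x y **h idm z) ;; assoc H y x z
    ;; (idm y **h swap_braiding x z).
Proof.
(* The hexagon follows formally from the three diagrams; the arrows are
   generalized so that rewriting does not unfold them. *)
have := dist_right_vh_flip x y z; have := dist_left_vh_flip x y z.
have := dist_left_vh_iso x y z; rewrite /swap_braiding.
move: (dist_left x y z) (dist_right x y z) (vh_iso x (y *h z)).
move: (vh_flip x (y *h z)) (vh_iso x y) (vh_flip x y).
move: (vh_iso x z) (vh_flip x z).
move=> phi2 psi2 psi phi1 psi1 dl dr phi e1 e3 e2.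
have e4 : phi ;; inv (assoc H x y z) = dl ;; (phi1 **h idm z).
  by rewrite -e1 comp_assoc iso_fwd_inv comp_idr.
apply: (comp_isoI (f := comp_iso phi (inv_iso (assoc H x y z)))) => /=.
rewrite [in RHS]e4 !comp_assoc.
rewrite (comp_cut _ (iso_inv_fwd (assoc _ _ _ _))) comp_idl.
rewrite (comp_cut _ (iso_fwd_inv phi)) comp_idl -e2.
rewrite (comp_cut _ (eq_sym (tmor_comp H _ _ _ _))) comp_idl.
rewrite (comp_cut _ (iso_fwd_inv phi1)) comp_idl -!comp_assoc e3 comp_assoc.
by rewrite -tmor_comp (comp_cut _ (iso_fwd_inv phi2)) !comp_idl.
Qed.

End EckmannHilton.

Theorem swap_braiding_is_braiding (C : category) (I : C) (V H : monoidal I)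
    (S : weak_interchange V H) :
  is_braiding (M := H) (fun a b => swap_braiding S a b).
Proof.
split.
- move=> a b.
  exact: iso_is_iso (comp_iso (inv_iso (vh_iso S a b)) (vh_flip S a b)).
- by move=> *; exact: swap_braiding_nat.
- by move=> *; exact: swap_braiding_hexagon.
(* By computation, the reversed braiding at (z, y) is the braiding at (y, z),
   and the reversed associator at (z, y, x) the inverse one at (x, y, z). *)
- move=> x y z; exact: (swap_braiding_hexagon (rev_interchange S) z y x).
Qed.

(** * Strict interchange *)

Section Strict.
Variable C : category.

Definition eq_iso (a b : C) (p : a = b) : iso a b.
Proof.
by refine (@Iso C a b (eq_hom p) (eq_hom (eq_sym p)) _ _); case: _ / p;
  exact: comp_idl.
Defined.

(** The equalities p and q are arbitrary, since uniqueness of identity proofs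
    identifies them with those that [f == g] entails. *)
Lemma hom_eq_square (a b c d : C) (f : hom a b) (g : hom c d)
    (p : a = c) (q : b = d) :
  f == g -> f ;; eq_hom q = eq_hom p ;; g.
Proof.
move=> e; case: _ _ _ / e p q => p q.
by rewrite (UIP_refl _ _ p) (UIP_refl _ _ q) comp_idr comp_idl.
Qed.

Lemma hom_eq_source (a b c d : C) (f : hom b d) (g : hom c d)
    (p : a = b) (q : a = c) :
  f == g -> eq_hom p ;; f = eq_hom q ;; g.
Proof.
case: _ / p f => f /(hom_eq_square q eq_refl) <- /=.
by rewrite comp_idl comp_idr.
Qed.

Lemma hom_eq_idm (a b : C) (f : hom a b) (p : a = b) :
  f == idm b -> f = eq_hom p.
Proof.
by move/(hom_eq_square p eq_refl); rewrite /= !comp_idr.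
Qed.

Lemma eq_hom_trans (a b c : C) (p : a = b) (q : b = c) :
  eq_hom p ;; eq_hom q = eq_hom (eq_trans p q).
Proof. by case: _ / q; exact: comp_idr. Qed.

Lemma tmor_eq_hom (I : C) (M : monoidal I) (a b c d : C) (p : a = b)
    (q : c = d) :
  tmor M (eq_hom p) (eq_hom q) = eq_hom (f_equal2 (tob M) p q).
Proof.
(* [f_equal2] does not compute, even on reflexivity proofs. *)
by case: _ / p; case: _ / q; rewrite (UIP_refl _ _ (f_equal2 _ _ _)) /= tmor_id.
Qed.

End Strict.

Definition strict_interchange (C : two_monoidal_category) :
  weak_interchange (vmon C) (hmon C).
Proof.
refine (@WeakInterchange C (unit_ob C) (vmon C) (hmon C)
  (fun a b c d => eq_iso (interchange a b c d)) _ _ _ _) => /=.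
- move=> a b c d a' b' c' d' f g k m.
  by apply: hom_eq_square; exact: interchange_mor.
- move=> a b c d e f; symmetry.
  rewrite -[idm (c *v f)]/(eq_hom eq_refl) -[idm (a *v d)]/(eq_hom eq_refl).
  rewrite !tmor_eq_hom comp_assoc !eq_hom_trans.
  by apply: hom_eq_square; exact: hassoc_v.
- move=> a b; symmetry.
  rewrite (hom_eq_idm (hunit_unit C) (hlunit_unit C)).
  rewrite -[idm (a *h b)]/(eq_hom eq_refl) tmor_eq_hom.
  by apply: hom_eq_source; exact: vlunit_h.
- move=> a b; symmetry.
  rewrite (hom_eq_idm (hunit_unit C) (hrunit_unit C)).
  rewrite -[idm (a *h b)]/(eq_hom eq_refl) tmor_eq_hom.
  by apply: hom_eq_source; exact: vrunit_h.
Defined.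

Lemma eh_braidingE (C : two_monoidal_category) (a b : C) :
  swap_braiding (strict_interchange C) a b = eh_braiding a b.
Proof. by rewrite /swap_braiding /eh_braiding /= !comp_assoc. Qed.

Theorem theorem2p1 (C : two_monoidal_category) :
  is_braiding (M := hmon C) (fun a b : C => eh_braiding a b).
Proof.
have [ci cn hf hi] := swap_braiding_is_braiding (strict_interchange C).
split=> *; rewrite -!eh_braidingE.
- exact: ci.
- exact: cn.
- exact: hf.
- exact: hi.
Qed.
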